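(* Let $p=p(n)$ satisfy $n^{-0.4}\le p\le 1$, and let $G\sim G(n,p)$. Then with high probability $r_g(G,\mathcal{H})=\delta(G)-1$.
   Context: $G(n,p)$ is the binomial random graph on $n$ labelled vertices in which each pair is an edge independently with probability $p$. ''With high probability'' means with probability tending to $1$ as $n\to\infty$. $\mathcal{H}$ denotes the property of being Hamiltonian. For a graph $G$ and a monotone increasing graph property $\mathcal{P}$, the global resilience is $r_g(G,\mathcal{P})=\min\{m\in\mathbb{N}: \exists H\subseteq G \text{ with } e(H)=m \text{ such that } G\setminus H\notin\mathcal{P}\}$, where $G\setminus H$ is the graph on $V(G)$ with edge set $E(G)\setminus E(H)$. $\delta(G)$ is the minimum degree of $G$. *)

(* Defs.v *)
From mathcomp Require Import all_boot all_order all_algebra.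
From mathcomp Require Import all_classical all_reals all_analysis.

Set Implicit Arguments.
Unset Strict Implicit.
Unset Printing Implicit Defensive.

Import Order.TTheory GRing.Theory Num.Theory.
Import numFieldNormedType.Exports.

(* A simple graph with vertex set T is identified with its edge set, a set of
   two-element subsets of T, i.e. a subset of [pairs T]. *)
Notation edge_set T := {set {set T}}.

Definition pairs (T : finType) : edge_set T := [set e : {set T} | #|e| == 2].

Definition adjacent (T : finType) (G : edge_set T) : rel T :=
  fun x y => [set x; y] \in G.

Definition degree (T : finType) (G : edge_set T) (v : T) : nat :=
  #|[set e in G | v \in e]|.

(* Every degree is smaller than #|T|, so the default value is reached only
   when T is empty. *)
Definition min_degree (T : finType) (G : edge_set T) : nat :=
  \big[minn/#|T|]_(v : T) degree G v.

(* The bound on #|T| excludes the degenerate closed walks of length at most 2,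
   for which [cycle] would traverse the same edge back and forth. *)
Definition hamiltonian (T : finType) (G : edge_set T) : bool :=
  (2 < #|T|) && [exists c : #|T|.-tuple T, ucycleb (adjacent G) c].

(* The default value #|G|.+1 is reached only when no deletion of edges destroys
   the property P, i.e. when the minimum is over the empty set; this does not
   happen for P := hamiltonian, as the edgeless graph is not Hamiltonian. *)
Definition global_resilience (T : finType) (P : pred (edge_set T))
    (G : edge_set T) : nat :=
  \big[minn/#|G|.+1]_(H : edge_set T | (H \subset G) && ~~ P (G :\: H)) #|H|.

Local Open Scope ring_scope.

(* Probability of the event A under the binomial random graph G(n, p). *)
Definition gnp_prob (R : realType) (n : nat) (p : R)
    (A : pred (edge_set 'I_n)) : R :=
  \sum_(G : edge_set 'I_n | (G \subset pairs 'I_n) && A G)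
    \prod_(e in pairs 'I_n) (if e \in G then p else 1 - p).

Lemma global_resilience_hamiltonian_le (T : finType) (G : edge_set T) :
  (global_resilience (@hamiltonian T) G <= #|G|)%N.
Proof.
rewrite /global_resilience -minEnat; apply: (@bigmin_le_cond _ nat _ _ G).
rewrite subxx finset.setDv /hamiltonian /=; case: ltnP => //= T2.
apply/existsP => -[[[|x s] /= /eqP sz]]; first by rewrite -sz in T2.
by case/andP; case: s sz => [|y s] sz /=; rewrite /adjacent inE.
Qed.

(* This identity for all F characterises the law of G(n, p). *)
Lemma gnp_prob_supset (R : realType) (n : nat) (p : R) (F : edge_set 'I_n) :
  F \subset pairs 'I_n ->
  gnp_prob p (fun G => F \subset G) = p ^+ #|F|.
Proof.
move=> FP; rewrite /gnp_prob.
pose w (e : {set 'I_n}) (b : bool) : R :=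
  if e \in pairs 'I_n then (if b then p else if e \in F then 0 else 1 - p)
  else (if b then 0 else 1).
transitivity (\prod_(e : {set 'I_n}) \sum_(b : bool) w e b); last first.
  rewrite (bigID (mem F)) /= [X in _ * X]big1 => [|e eF].
    rewrite mulr1 -prodr_const; apply: eq_bigr => e eF.
    by rewrite big_bool /w (fintype.subsetP FP _ eF) eF /= addr0.
  rewrite big_bool /w (negbTE eF); case: ifP => _; first by rewrite /= addrC subrK.
  by rewrite /= add0r.
rewrite bigA_distr_bigA /=.
rewrite (reindex (fun f : {ffun {set 'I_n} -> bool} => [set e | f e])) /=; last first.
  exists (fun G : edge_set 'I_n => [ffun e => e \in G]) => [f _|G _].
    by apply/ffunP => e; rewrite ffunE inE.
  by apply/finset.setP => e; rewrite inE ffunE.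
rewrite big_mkcond /=; apply: eq_bigr => f _.
set G := [set e | f e]; have inG e : (e \in G) = f e by rewrite inE.
case: ifPn => [/andP[GP FG]|].
  rewrite big_mkcond /=; apply: eq_bigr => e _; rewrite /w inG.
  case: ifPn => eP.
    case: ifPn => // fe; case: ifP => // eF.
    by rewrite -inG (fintype.subsetP FG _ eF) in fe.
  case: ifP => // fe; rewrite -inG in fe.
  by rewrite (fintype.subsetP GP _ fe) in eP.
rewrite negb_and => /orP[] /fintype.subsetPn[e].
  by rewrite inG => fe eP; rewrite (bigD1 e) //= /w (negbTE eP) fe mul0r.
rewrite inG => eF /negbTE fe.
by rewrite (bigD1 e) //= /w (fintype.subsetP FP _ eF) fe eF mul0r.
Qed.

(* Main.v *)
(* The resilience is at most delta - 1 because a vertex of degree 1 lies on no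
   cycle. For the other bound, delete a set H of at most delta - 2 edges.
   Let v have minimum degree in G \ H: it keeps two neighbours x, y, and every
   other vertex keeps at least (delta + 1) / 2 neighbours, since two vertices
   share at most one edge. Take k close to 4 sqrt n. With high probability
   every two disjoint k-sets span at least p k^2 / 4 >= 4 p n >= delta edges of
   G, so they are still joined after the deletion; this uses p k >> log n. As
   sqrt n << p n, all degrees but that of v are much larger than k. A longest
   path from x to y avoiding v then contains every other vertex, by an argument
   of Chvatal-Erdos type: if u is off the path and has 2k neighbours on it,
   then two of their successors are adjacent and the path can be rotated
   through u; if no vertex off the path has that many, these vertices have many
   neighbours among themselves, and a detour through them fits between two
   consecutive vertices of the path. *)

Require Import Defs.
From mathcomp Require Import all_boot all_order all_algebra.
From mathcomp Require Import all_classical all_reals all_analysis.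
From mathcomp Require Import zify ring lra.

Import Order.TTheory GRing.Theory Num.Theory.
Import numFieldNormedType.Exports.
(* Gives the finset lemmas precedence over their classical_sets homonyms, and
   [Defs.adjacent] over the one of the analysis library. *)
Import boot.fintype boot.finset.
Import Defs.

(** * Longest paths in graphs without large holes *)

Lemma subset_of_card {T : finType} (A : {set T}) k :
  k <= #|A| -> exists2 B : {set T}, B \subset A & #|B| = k.
Proof.
move=> kA; have : 0 < #|[set B : {set T} | B \subset A & #|B| == k]|.
  by rewrite cards_draws bin_gt0.
by case/card_gt0P=> B; rewrite inE => /andP[? /eqP]; exists B.
Qed.

Lemma path_split_not {T : Type} (r : rel T) x s :
  ~~ path r x s ->
  exists s1 z s2, s = s1 ++ z :: s2 /\ ~~ r (last x s1) z.
Proof.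
elim: s x => [//|z s IH] x /=; rewrite negb_and => /orP[nr|/IH].
  by exists [::], z, s.
by case=> s1 [w [s2 [-> nr]]]; exists (z :: s1), w, s2.
Qed.

Lemma path_or_count {T : Type} (q : pred T) x s :
  path (fun a b => q a || q b) x s -> size s <= 2 * count q (x :: s).
Proof.
(* The summand [q x] makes the induction work: a new edge adds 1, and [q] holds at one of its
   ends. *)
suff H : path (fun a b => q a || q b) x s ->
    size s + q x <= 2 * count q (x :: s).
  by move=> /H; apply: leq_trans; rewrite leq_addr.
elim: s x => [|z s IH] x /=; first by case: (q x).
by case/andP=> qxz /IH /= H; case: (q x) (q z) qxz H => [] [] //= _; lia.
Qed.

Section LongestPath.

Context {T : finType} (e : rel T) (k : nat).
Hypothesis e_sym : symmetric e.
Hypothesis e_join : forall A B : {set T}, [disjoint A & B] ->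
  k <= #|A| -> k <= #|B| -> exists a b, [/\ a \in A, b \in B & e a b].

Let N (u : T) : {set T} := [set w | e u w].

(** Either the two neighbourhoods in [W] meet, which gives a single inner vertex, or they are
    disjoint and [e_join] gives an edge between them. *)
Lemma connect_through (W : {set T}) a b :
  k <= #|N a :&: W| -> k <= #|N b :&: W| ->
  exists s, [/\ uniq s, {subset s <= W}, s != [::] & path e a (rcons s b)].
Proof.
move=> ka kb; have [dis|] := boolP [disjoint N a :&: W & N b :&: W].
  have [w1 [w2 [w1a w2b e12]]] := e_join _ _ dis ka kb.
  have n12 : w1 != w2.
    by apply/eqP => E; rewrite -E in w2b; rewrite (disjointFr dis w1a) in w2b.
  move: w1a w2b; rewrite !inE => /andP[ea W1] /andP[eb W2].
  exists [:: w1; w2]; split=> //=.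
  - by rewrite inE n12.
  - by move=> z; rewrite !inE => /orP[]/eqP->.
  - by rewrite ea e12 e_sym eb.
rewrite -setI_eq0 => /set0Pn[w]; rewrite !inE => /andP[/andP[ea W1] /andP[eb _]].
exists [:: w]; split=> //=; first by move=> z; rewrite inE => /eqP->.
by rewrite ea e_sym eb.
Qed.

Lemma two_halves (S : {set T}) : 2 * k <= #|S| ->
  exists a b, [/\ a \in S, b \in S, a != b & e a b].
Proof.
move=> kS; have [|A AS cA] := subset_of_card S k.
  by apply: leq_trans kS; rewrite leq_pmull.
have dis : [disjoint A & S :\: A].
  by rewrite -setI_eq0 setIDA setIC setDIl setDv setI0.
have cB : k <= #|S :\: A|.
  by rewrite cardsD (setIidPr AS) cA; lia.
have [a [b [aA bB eab]]] := e_join _ _ dis (eq_leq (esym cA)) cB.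
exists a, b; split=> //; first exact: (subsetP AS).
  by move: bB; rewrite inE => /andP[].
by apply: contraL bB => /eqP <-; rewrite inE aA.
Qed.

Context (v x y : T).
Hypothesis evx : e v x.
Hypothesis evy : e v y.
Hypothesis xNy : x != y.
Hypothesis vNx : v != x.
Hypothesis vNy : v != y.
(** [v] is exempt because it may keep only the two neighbours [x] and [y]. *)
Hypothesis degD : forall u, u != v -> 3 * k + 4 <= #|N u|.

(** Such a path closes to a cycle through [v], Hamiltonian once the path covers all other
    vertices. *)
Let valid s := [&& path e x s, uniq (x :: s), last x s == y & v \notin x :: s].

Lemma greedy_path m : m <= 2 * k ->
  exists s, [/\ path e x s, uniq (x :: s), size s = m
    & (v \notin x :: s) && (y \notin x :: s)].
Proof.
elim: m => [|m IH] mk.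
  by exists [::]; split=> //; rewrite !inE vNx eq_sym xNy.
have [s [ps us ss /andP[vs ys]]] := IH (ltnW mk).
set z := last x s; have zs : z \in x :: s by exact: mem_last.
have zv : z != v by apply: contraNneq vs => <-.
(* At most [2 * k + 2] vertices are forbidden; [y] is among them because it is kept for the end of
   the path. *)
have : ~~ (N z \subset [set w in v :: y :: x :: s]).
  apply/negP => /subset_leq_card; apply/negP; rewrite -ltnNge.
  apply: leq_trans (degD z zv); rewrite cardsE.
  by apply: leq_ltn_trans (card_size _) _; rewrite /= ss; move: mk; clear; lia.
case/subsetPn=> w; rewrite !inE => ezw.
rewrite !negb_or => /and4P[wv wy wx ws].
exists (rcons s w); split.
- by rewrite rcons_path ps.
- by rewrite -rcons_cons rcons_uniq us inE negb_or wx ws.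
- by rewrite size_rcons ss.
by rewrite -rcons_cons !mem_rcons !inE !negb_or
  -!(eq_sym w) wv wy /=; move: vs ys; rewrite !inE !negb_or => -> ->.
Qed.

(** A greedy path with [2 * k] edges is joined to [y] through vertices not yet visited. The length
    is what [extend_detour] asks for. *)
Lemma long_valid : exists s, valid s && (2 * k < size s).
Proof.
have [s [ps us ss /andP[vs ys]]] := greedy_path (2 * k) (leqnn _).
set z := last x s; have zs : z \in x :: s by exact: mem_last.
have zv : z != v by apply: contraNneq vs => <-.
pose W := ~: [set w in v :: y :: x :: s].
have deg u : u != v -> k <= #|N u :&: W|.
  move=> /degD du; have := cardsID [set w in v :: y :: x :: s] (N u).
  rewrite setDE -/W => E.
  have : #|N u :&: [set w in v :: y :: x :: s]| <= 2 * k + 3.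
    apply: leq_trans (subset_leq_card (subsetIr _ _)) _; rewrite cardsE.
    by apply: leq_trans (card_size _) _; rewrite /= ss addnC.
  by move: du E; clear; lia.
have yv : y != v by rewrite eq_sym.
have [t [ut tW t0 pt]] := connect_through W z y (deg _ zv) (deg _ yv).
have tn w : w \in t -> [&& w != v, w != y & w \notin x :: s].
  by move/tW; rewrite !inE !negb_or.
exists (s ++ rcons t y); apply/andP; split; last first.
  by rewrite size_cat ss size_rcons -addSnnS leq_addr.
apply/and4P; split.
- by rewrite cat_path ps.
- rewrite -cat_cons cat_uniq us rcons_uniq ut andbT.
  have -> : y \notin t by apply/negP => /tn /and3P[_ /eqP].
  rewrite andbT; apply/hasPn => w; rewrite mem_rcons inE => /orP[/eqP->//|].
  by case/tn/and3P.
- by rewrite last_cat last_rcons.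
- rewrite -cat_cons mem_cat (negPf vs) mem_rcons inE (negPf vNy) /=.
  by apply/negP => /tn /andP[/eqP].
Qed.

(* The predecessor of c on the path x :: s. *)
Let prd (s : seq T) c := nth x (x :: s) (index c s).

Lemma prd_cat s1 c s2 : uniq (s1 ++ c :: s2) -> prd (s1 ++ c :: s2) c = last x s1.
Proof.
rewrite cat_uniq /= negb_or => /and3P[_ /andP[cs1 _] _].
rewrite /prd index_cat (negPf cs1) /= eqxx addn0 -cat_cons nth_cat /= ltnS leqnn.
by rewrite -last_nth.
Qed.

(** Exactly the vertices of [belast x s] have a successor on the path. The successors of neighbours
    of [u] are at least [2 * k] many, so [two_halves] finds an edge among them. *)
Lemma extend_rotation s u : valid s -> u \notin v :: x :: s ->
  2 * k <= #|N u :&: [set w in belast x s]| ->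
  exists2 t, valid t & size t = (size s).+1.
Proof.
case/and4P=> ps us /eqP ls vs; rewrite inE negb_or => /andP[uv uxs] kN.
pose S := [set c in s | e u (prd s c)].
have : 2 * k <= #|S|.
  apply: leq_trans kN (leq_trans (subset_leq_card _) (leq_imset_card (prd s) _)).
  apply/subsetP => z; rewrite !inE => /andP[euz zs].
  have [i si zE] : exists2 i, i < size s & z = nth x (x :: s) i.
    exists (index z (belast x s)); first by rewrite -(size_belast x) index_mem.
    rewrite lastI nth_rcons index_mem zs nth_index //.
  have iE : index (nth x s i) s = i by rewrite index_uniq //; case/andP: us.
  apply/imsetP; exists (nth x s i); last by rewrite /prd iE.
  by rewrite inE mem_nth //= /prd iE -zE.
case/two_halves=> c [d [+ + ncd ecd]].
(* [main] takes [c] before [d] on the path; the other order follows by symmetry. *)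
have main : forall c d s1 s2 s3, c != d -> e c d -> s = s1 ++ c :: s2 ++ d :: s3 ->
    e u (prd s c) -> e u (prd s d) -> exists2 t, valid t & size t = (size s).+1.
  move=> {c d ncd ecd S} c d s1 s2 s3 ncd ecd sE.
  have uss : uniq s by case/andP: us.
  have -> : prd s c = last x s1 by rewrite sE prd_cat // -sE.
  have -> : prd s d = last c s2.
    have sE' : s = (s1 ++ c :: s2) ++ d :: s3 by rewrite sE -catA.
    by rewrite sE' prd_cat -?sE' // last_cat.
  (* From the predecessor of [c] the new path goes to [u], then to the predecessor of [d], backwards
     to [c], and over the edge [c d] to the rest. *)
  move=> euc eud; exists (s1 ++ u :: rev (c :: s2) ++ d :: s3); last first.
    by rewrite sE size_cat /= size_cat size_rev /= !size_cat /= size_cat /=; clear; lia.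
  have PE : perm_eq (x :: s1 ++ u :: rev (c :: s2) ++ d :: s3) (u :: x :: s).
    apply/permP => a; rewrite sE /= !(count_cat, count_rev) /= !count_cat count_rev /=.
    by clear; lia.
  apply/and4P; split.
  - have := ps; rewrite sE cat_path /= cat_path /=.
    case/and5P=> p1 _ p2 _ p3.
    have lr : last u (rev (c :: s2)) = c by rewrite rev_cons last_rcons.
    rewrite cat_path p1 -cat1s /= (e_sym _ u) euc cat_path lr /= ecd p3 andbT.
    rewrite lastI rev_rcons /= eud rev_path.
    by rewrite (@eq_path _ _ e) ?p2 // => a b /=; rewrite e_sym.
  - by rewrite (perm_uniq PE) cons_uniq uxs.
  - by rewrite -ls sE last_cat /= last_cat /= last_cat /= last_cat.
  - by rewrite (perm_mem PE) inE negb_or eq_sym uv.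
rewrite !inE => /andP[cs euc] /andP[+ eud].
have [s1 [s2 sE]] : exists s1 s2, s = s1 ++ c :: s2.
  by case/splitPr: cs => s1 s2; exists s1, s2.
rewrite {1}sE mem_cat inE [d == c]eq_sym (negPf ncd) /= => /orP[] ds.
  have [t1 [t2 tE]] : exists t1 t2, s1 = t1 ++ d :: t2.
    by case/splitPr: ds => t1 t2; exists t1, t2.
  apply: (main d c t1 t2 s2) => //; rewrite 1?eq_sym 1?e_sym //.
  by rewrite sE tE -catA.
have [t1 [t2 tE]] : exists t1 t2, s2 = t1 ++ d :: t2.
  by case/splitPr: ds => t1 t2; exists t1, t2.
by apply: (main c d s1 t1 t2); rewrite // sE tE.
Qed.

(** Fewer than [k] path vertices have no neighbour in [W], by [e_join]. As the path has more than
    [2 * k] edges, two consecutive vertices both have one, by [path_or_count]. *)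
Lemma extend_detour s u : valid s -> u \notin v :: x :: s -> 2 * k < size s ->
  (forall w, w \notin v :: x :: s -> #|N w :&: [set w in belast x s]| < 2 * k) ->
  exists2 t, valid t & size s < size t.
Proof.
case/and4P=> ps us /eqP ls vs un ss few.
pose W := ~: [set w in v :: x :: s].
have deg w : w \notin v :: x :: s -> k + 2 <= #|N w :&: W|.
  move=> wn; have /degD dw : w != v by apply: contraNneq wn => ->; rewrite inE eqxx.
  have := cardsID [set w in v :: x :: s] (N w).
  rewrite setDE -/W => E.
  (* The 2 counts [v] and [y], the members of [v :: x :: s] outside [belast x s]. *)
  have : #|N w :&: [set w in v :: x :: s]| <= 2 + #|N w :&: [set w in belast x s]|.
    have sub : N w :&: [set w in v :: x :: s] \subset
        [set v; y] :|: N w :&: [set w in belast x s].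
      apply/subsetP => z /setIP[zN]; rewrite in_set in_cons lastI ls mem_rcons in_cons.
      rewrite in_setU in_set2 in_setI zN in_set.
      by case/or3P=> ->; rewrite ?orbT.
    apply: leq_trans (subset_leq_card sub) (leq_trans (leq_card_setU _ _) _).
    by rewrite leq_add2r cards2; case: (v != y).
  by have := few w wn; move: dw E; clear; lia.
pose q z := ~~ [exists w in W, e z w].
have cq : count q (x :: s) < k.
  have -> : count q (x :: s) = #|[set z in x :: s | q z]|.
    rewrite -size_filter -(card_uniqP _) ?filter_uniq // cardsE.
    by apply: eq_card => z; rewrite mem_filter !inE andbC.
  rewrite ltnNge; apply/negP => kq.
  have kW : k <= #|W|.
    apply: leq_trans (leq_trans _ (deg u un)) (subset_leq_card (subsetIr _ _)).
    exact: leq_addr.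
  have dis : [disjoint [set z in x :: s | q z] & W].
    rewrite -setI_eq0; apply/eqP/setP => z; rewrite !inE.
    by apply/negP => /andP[/andP[-> _]]; rewrite orbT.
  have [a [b [+ bW eab]]] := e_join _ _ dis kq kW.
  by rewrite inE => /andP[_] /existsP; case; exists b; rewrite bW.
have : ~~ path (fun a b => q a || q b) x s.
  by apply/negP => pq; have := path_or_count q x s pq; move: cq ss; clear; lia.
move=> npq; have [s1 [b [s2 [sE]]]] := path_split_not _ x s npq.
rewrite negb_or !negbK.
case/andP=> /existsP[w1 /andP[W1 e1]] /existsP[w2 /andP[W2 e2]].
have [t [ut tW t0 pt]] : exists t, [/\ uniq t, {subset t <= W}, t != [::]
    & path e (last x s1) (rcons t b)].
  (* If [w1] and [w2] differ, they are removed from [W] to keep the detour simple; of the [k + 2]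
     neighbours in [W] at least [k] remain. *)
  have [E|n12] := eqVneq w1 w2.
    exists [:: w1]; split=> //=; first by move=> z; rewrite inE => /eqP->.
    by rewrite e1 e_sym E e2.
  have deg' w : w \in W -> k <= #|N w :&: (W :\: [set w1; w2])|.
    move=> wW; have /deg dw : w \notin v :: x :: s by move: wW; rewrite !inE.
    rewrite setIDA cardsD.
    have := subset_leq_card (subsetIr (N w :&: W) [set w1; w2]).
    by rewrite cards2 n12; move: dw; clear; lia.
  have [t [ut tW t0 pt]] := connect_through _ w1 w2 (deg' _ W1) (deg' _ W2).
  have tW' z : z \in t -> [&& z != w1, z != w2 & z \in W].
    by move/tW; rewrite !inE !negb_or -andbA.
  exists (w1 :: rcons t w2); split=> //.
  - rewrite /= rcons_uniq ut mem_rcons inE negb_or n12 andbT /=.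
    by apply/andP; split; apply/negP => /tW'/and3P[/eqP ? /eqP].
  - by move=> z; rewrite inE mem_rcons inE => /or3P[/eqP->|/eqP->|/tW'/and3P[]].
  - by rewrite /= e1 rcons_path pt last_rcons e_sym e2.
have PE : perm_eq (x :: s1 ++ t ++ b :: s2) (t ++ x :: s).
  by apply/permP => a; rewrite sE /= !count_cat /= !count_cat /=; clear; lia.
have tn w : w \in t -> w \notin v :: x :: s by move/tW; rewrite !inE.
exists (s1 ++ t ++ b :: s2); last first.
  by rewrite sE !size_cat /=; case: (t) t0 => //= *; clear; lia.
apply/and4P; split.
- move: ps pt; rewrite sE !cat_path /= rcons_path.
  by case/and3P=> -> _ -> /andP[-> ->].
- rewrite (perm_uniq PE) cat_uniq ut us andbT andTb; apply/hasPn => w ws.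
  by apply/negP => /tn; rewrite inE negb_or ws andbF.
- by rewrite -ls sE !last_cat /=.
- rewrite (perm_mem PE) mem_cat negb_or vs andbT.
  by apply/negP => /tn; rewrite inE eqxx.
Qed.

Lemma hamiltonian_cycle : exists c : #|T|.-tuple T, ucycleb e c.
Proof.
(* The length bound is part of the maximised property, so that [extend_detour] applies to the
   longest path. *)
pose P m := `[< exists s, valid s && (2 * k < size s) /\ size s = m >].
have [s0 s0P] := long_valid.
have exP : exists m, P m by exists (size s0); apply/asboolP; exists s0.
have bound m : P m -> m <= #|T|.
  case/asboolP=> s [/andP[/and4P[_ /= /andP[_ us] _ _] _] <-].
  by rewrite -(card_uniqP us) max_card.
case: (ex_maxnP exP bound) => m /asboolP[s [/andP[vs ss] sm]] maxm.
have full u : u \in v :: x :: s.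
  apply/negPn/negP => un.
  have [t vt st] : exists2 t, valid t & size s < size t.
    have [[w /andP[wn kw]]|few] := pselect (exists w, (w \notin v :: x :: s) &&
        (2 * k <= #|N w :&: [set w in belast x s]|)).
      by have [t vt st] := extend_rotation _ _ vs wn kw; exists t; rewrite // st.
    apply: extend_detour un ss _ => // w wn.
    by rewrite ltnNge; apply/negP => kw; apply: few; exists w; rewrite wn.
  have : size t <= m.
    by apply/maxm/asboolP; exists t; rewrite vt (ltn_trans ss st).
  by rewrite -sm leqNgt st.
case/and4P: vs => ps us /eqP ls vs.
have uvs : uniq (v :: x :: s) by rewrite cons_uniq vs us.
have sz : size (v :: x :: s) == #|T|.
  by rewrite -(card_uniqP uvs); apply/eqP/eq_card => z; rewrite full.
exists (Tuple sz); rewrite /ucycleb uvs andbT /=.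
by rewrite evx rcons_path ps ls e_sym evy.
Qed.

End LongestPath.

(** * Deterministic bounds on the resilience *)

Section Resilience.

Context {T : finType}.
Implicit Types (G H : edge_set T) (A B : {set T}) (u v w : T).

Lemma adjacent_sym G : symmetric (adjacent G).
Proof. by move=> u w; rewrite /adjacent setUC. Qed.

Lemma adjacent_irr G u : G \subset pairs T -> adjacent G u u = false.
Proof.
move=> GP; apply/negP => /(subsetP GP); rewrite inE.
by rewrite setUid cards1.
Qed.

Lemma degree_card G u : G \subset pairs T ->
  degree G u = #|[set w | adjacent G u w]|.
Proof.
move=> GP; rewrite /degree.
have -> : [set e in G | u \in e] =
    [set [set u; w] | w in [set w | adjacent G u w]].
  apply/setP => e; rewrite inE; apply/andP/imsetP.
    case=> eG ue; have := subsetP GP _ eG; rewrite inE => /cards2P[a [b [nab eE]]].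
    move: ue; rewrite eE !inE => /orP[]/eqP uE.
      by exists b; rewrite uE ?inE /adjacent -?eE.
    by exists a; rewrite uE ?inE /adjacent [[set b; a]]setUC -?eE.
  by case=> w; rewrite inE /adjacent => aw ->; rewrite aw set21.
apply: card_in_imset => w1 w2; rewrite !inE => a1 a2 E.
have : w1 \in [set u; w2] by rewrite -E set22.
rewrite !inE => /orP[]/eqP // w1u.
by rewrite w1u adjacent_irr in a1.
Qed.

Lemma min_degree_le G u : min_degree G <= degree G u.
Proof. by rewrite /min_degree -minEnat; apply: (@bigmin_le _ nat). Qed.

Lemma min_degree_attained G u0 : G \subset pairs T ->
  exists u, degree G u = min_degree G.
Proof.
move=> GP; rewrite /min_degree -minEnat.
rewrite (@bigmin_eq_arg _ nat _ _ u0) //; last first.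
  by move=> i _; rewrite degree_card // leEnat max_card.
by eexists.
Qed.

(** In the cycle rotated to start at [u], the second and the last vertex are neighbours of [u]; they
    differ since there are at least three vertices. *)
Lemma hamiltonian_degree G u : G \subset pairs T -> hamiltonian G ->
  1 < degree G u.
Proof.
move=> GP /andP[T2 /existsP[c /andP[cc uc]]].
have uin : u \in c.
  have /subset_leqif_cards/leqifP : [set w in c] \subset [set: T] by exact: subsetT.
  rewrite cardsT cardsE (card_uniqP uc) size_tuple.
  case: eqP => [E _|]; last by rewrite ltnn.
  by have := in_setT u; rewrite -E inE.
have [i s rs] := rot_to uin.
have := rot_cycle i (adjacent G) c; rewrite rs cc => cs.
have := rot_uniq i c; rewrite rs uc => us.
have ss : (size s).+1 = #|T| by rewrite -[RHS](size_tuple c) -(size_rot i c) rs.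
case: s rs cs us ss => [|a [|b s]] rs cs us ss; [by rewrite -ss in T2..|].
rewrite degree_card //; apply/card_gt1P; exists a, (last b s).
move: cs; rewrite /= rcons_path => /and4P[ua _ _ lu]; split; rewrite ?inE //.
  by rewrite adjacent_sym.
by apply: contraTneq us => ->; rewrite /= mem_last !andbF.
Qed.

(** One edge [e0] at [u] is kept and all others at [u] are deleted. *)
Lemma resilience_le_degree G u : G \subset pairs T -> 0 < degree G u ->
  global_resilience (@hamiltonian T) G <= (degree G u).-1.
Proof.
move=> GP; rewrite /degree => d0; have /card_gt0P[e0 e0S] := d0.
set S := [set e in G | u \in e] in d0 e0S *.
have -> : #|S|.-1 = #|S :\ e0| by rewrite (cardsD1 e0 S) e0S.
rewrite /global_resilience -minEnat; apply: (@bigmin_le_cond _ nat _ _ (S :\ e0)).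
apply/andP; split; first by apply/subsetP => e; rewrite !inE => /and3P[].
apply/negP => /(@hamiltonian_degree _ u (subset_trans (subsetDl _ _) GP)).
rewrite ltnNge => /negP; apply.
rewrite -(cards1 e0) /degree; apply/subset_leq_card/subsetP => e.
by rewrite /S !inE => /andP[/andP[+ eG] ue]; rewrite eG ue !andbT negbK.
Qed.

Definition cut A B : edge_set T := [set [set a; b] | a in A, b in B].

Lemma cut_sub_pairs A B : [disjoint A & B] -> cut A B \subset pairs T.
Proof.
move=> dis; apply/subsetP => e /imset2P[a b aA bB ->]; rewrite inE cards2.
by case: (a =P b) => // E; rewrite -E (disjointFr dis aA) in bB.
Qed.

(** Disjointness tells which element of [[set a; b]] lies in [A], so the pair can be recovered. *)
Lemma card_cut A B : [disjoint A & B] -> #|cut A B| = (#|A| * #|B|)%N.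
Proof.
move=> dis; rewrite /cut curry_imset2X -cardsX; apply: card_in_imset.
move=> [a b] [a' b']; rewrite !inE /= => /andP[aA bB] /andP[aA' bB'] E.
have : a \in [set a'; b'] by rewrite -E set21.
rewrite !inE; case: eqP => [<- _|_ /eqP ab]; last first.
  by rewrite -ab (disjointFr dis aA) in bB'.
have : b \in [set a'; b'] by rewrite -E set22.
rewrite !inE; case/orP=> /eqP; last by move=> ->.
by move=> ba; rewrite ba (disjointFr dis aA') in bB.
Qed.

Lemma degreeD G H u : degree G u <= degree (G :\: H) u + #|H|.
Proof.
rewrite /degree.
have -> : [set e in G :\: H | u \in e] = [set e in G | u \in e] :\: H.
  by apply/setP => e; rewrite !inE andbA.
rewrite cardsD; have := subset_leq_card (subsetIr [set e in G | u \in e] H).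
by clear; lia.
Qed.

(** At most one edge contains both [u] and [v], so at most one deleted edge counts for both
    degrees. *)
Lemma degreeD2 G H u v : G \subset pairs T -> u != v ->
  degree G u + degree G v <= degree (G :\: H) u + degree (G :\: H) v + #|H| + 1.
Proof.
move=> GP uv; rewrite /degree.
set Su := [set e in G | u \in e]; set Sv := [set e in G | v \in e].
have DE w : [set e in G :\: H | w \in e] = [set e in G | w \in e] :\: H.
  by apply/setP => e; rewrite !inE andbA.
rewrite !DE -/Su -/Sv.
have c1 : #|Su :&: Sv| <= 1.
  rewrite -(cards1 [set u; v]); apply/subset_leq_card/subsetP => e.
  rewrite !inE => /andP[/andP[eG ue] /andP[_ ve]].
  have := subsetP GP _ eG; rewrite inE => /eqP e2.
  have sub : [set u; v] \subset e by apply/subsetP => w /set2P[]->.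
  by rewrite eq_sym eqEcard sub e2 cards2 uv.
have : #|Su :|: Sv| <= #|Su :\: H| + #|Sv :\: H| + #|H|.
  apply: leq_trans (leq_trans (leq_card_setU (Su :\: H :|: Sv :\: H) H) _).
    apply/subset_leq_card/subsetP => e; rewrite !in_setU !in_setD.
    by case: (e \in H); rewrite ?orbT ?orbF.
  by rewrite leq_add2r leq_card_setU.
have := cardsUI Su Sv; move: c1; clear; lia.
Qed.

Lemma resilience_ge G k : G \subset pairs T -> 0 < #|T| ->
  6 * k + 8 <= min_degree G ->
  (forall A B, [disjoint A & B] -> #|A| = k -> #|B| = k ->
     min_degree G <= #|G :&: cut A B|) ->
  (min_degree G).-1 <= global_resilience (@hamiltonian T) G.
Proof.
move=> GP T0 dk many; rewrite /global_resilience -minEnat.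
have /card_gt0P[u0 _] := T0.
apply/(@bigmin_geP _ nat); split.
  (* The default value [#|G|.+1] of the minimum exceeds every degree. *)
  have := min_degree_le G u0; rewrite leEnat /degree => dm.
  have : #|[set e in G | u0 \in e]| <= #|G|.
    by apply/subset_leq_card/subsetP => e; rewrite inE => /andP[].
  by move: dm; clear; lia.
move=> H /andP[HG]; apply: contraNT; rewrite leEnat -ltnNge => cH.
set G' := G :\: H.
have GP' : G' \subset pairs T by apply: subset_trans GP; exact: subsetDl.
(* [v] has minimum degree after the deletion. It keeps two edges, as [H] has at most
   [min_degree G - 2]. *)
have [v _ vmin] := arg_minnP (degree G') (isT : xpredT u0).
have : 1 < degree G' v.
  have := degreeD G H v; have := min_degree_le G v.
  by move: cH; rewrite -/G'; clear; lia.
rewrite degree_card // => /card_gt1P[x [y [+ + xy]]]; rewrite !inE => evx evy.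
have nvx : v != x by apply/eqP => E; rewrite -E adjacent_irr in evx.
have nvy : v != y by apply/eqP => E; rewrite -E adjacent_irr in evy.
apply/andP; split.
  have u : uniq [:: v; x; y] by rewrite /= !inE negb_or nvx nvy xy.
  by have := max_card [in [:: v; x; y]]; rewrite (card_uniqP u).
apply/existsP.
apply: (@hamiltonian_cycle T (adjacent G') k (adjacent_sym G') _ v x y) => //.
  move=> A B dis kA kB.
  have [A1 A1A cA] := subset_of_card _ _ kA.
  have [B1 B1B cB] := subset_of_card _ _ kB.
  have dis1 : [disjoint A1 & B1].
    by rewrite (disjointWl A1A) // (disjointWr B1B).
  (* The cut has at least [min_degree G] edges of [G], more than [H] can contain. *)
  have : ~~ (G :&: cut A1 B1 \subset H).
    apply/negP => /subset_leq_card; have := many _ _ dis1 cA cB.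
    by move: cH; clear; lia.
  case/subsetPn=> e; rewrite inE => /andP[eG /imset2P[a b aA bB eE]] eH.
  exists a, b; rewrite (subsetP A1A) ?(subsetP B1B) //; split=> //.
  by rewrite /adjacent -eE inE eH.
move=> u uv; rewrite -degree_card //.
(* By minimality of [v], twice the remaining degree of [u] is at least
   [2 * min_degree G - #|H| - 1], hence at least [min_degree G + 1] and so at least [6 * k + 9]. *)
have := degreeD2 G H u v GP uv; have := min_degree_le G u.
have := min_degree_le G v; have := vmin u isT; rewrite -/G'.
by move: cH dk; clear; lia.
Qed.

Lemma resilience_eq G k : G \subset pairs T -> 0 < #|T| ->
  6 * k + 8 <= min_degree G ->
  (forall A B, [disjoint A & B] -> #|A| = k -> #|B| = k ->
     min_degree G <= #|G :&: cut A B|) ->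
  (global_resilience (@hamiltonian T) G).+1 = min_degree G.
Proof.
move=> GP T0 dk many; have d0 : 0 < min_degree G by move: dk; clear; lia.
rewrite -(prednK d0); congr _.+1.
apply/eqP; rewrite eqn_leq (resilience_ge G k) // andbT.
have /card_gt0P[u0 _] := T0; have [u uE] := min_degree_attained G u0 GP.
by rewrite -uE; apply: resilience_le_degree; rewrite // uE.
Qed.

End Resilience.

(** * Tail bounds in G(n, p) *)

Local Open Scope ring_scope.

Section Gnp.

Context {R : realType} {n : nat} (p : R).
Hypothesis p01 : 0 <= p <= 1.
Implicit Types (G F : edge_set 'I_n) (A B : pred (edge_set 'I_n)).

Let w G : R := \prod_(e in pairs 'I_n) (if e \in G then p else 1 - p).

Let p_ge0 : 0 <= p. Proof. by case/andP: p01. Qed.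
Let q_ge0 : 0 <= 1 - p. Proof. by rewrite subr_ge0; case/andP: p01. Qed.

Let w_ge0 G : 0 <= w G.
Proof. by apply: prodr_ge0 => e _; case: ifP. Qed.

Lemma sum_edge_sets (a b : {set 'I_n} -> R) :
  \sum_(G : edge_set 'I_n | G \subset pairs 'I_n)
     \prod_(e in pairs 'I_n) (if e \in G then a e else b e) =
  \prod_(e in pairs 'I_n) (a e + b e).
Proof.
(* The weights 0 and 1 outside [pairs 'I_n] kill every set containing a non-pair and let the product
   run over all of [{set 'I_n}]. *)
pose a' e := if e \in pairs 'I_n then a e else 0.
pose b' e := if e \in pairs 'I_n then b e else 1.
transitivity (\prod_(e : {set 'I_n}) (a' e + b' e)); last first.
  rewrite [RHS]big_mkcond; apply: eq_bigr => e _; rewrite /a' /b'.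
  by case: ifP => // _; rewrite add0r.
rewrite bigA_distr big_mkcond; apply: eq_bigr => G _; case: ifPn => [GP|].
  rewrite big_mkcond; apply: eq_bigr => e _; rewrite /a' /b'.
  case: ifPn => eP //; case: ifP => // eG.
  by rewrite (subsetP GP _ eG) in eP.
case/subsetPn=> e eG eP; rewrite (bigD1 e) //= eG /a' (negPf eP).
by rewrite mul0r.
Qed.

Lemma gnp_prob_predC A : gnp_prob p A = 1 - gnp_prob p (predC A).
Proof.
apply/eqP; rewrite -subr_eq opprK; apply/eqP.
rewrite /gnp_prob /= -(bigID A (fun G => G \subset pairs 'I_n) w) /w sum_edge_sets.
by rewrite big1 // => e _; rewrite addrC subrK.
Qed.

Lemma gnp_prob_markov A (f : edge_set 'I_n -> R) :
  (forall G, 0 <= f G) -> (forall G, A G -> 1 <= f G) ->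
  gnp_prob p A <= \sum_(G : edge_set 'I_n | G \subset pairs 'I_n) w G * f G.
Proof.
move=> f0 f1; rewrite /gnp_prob big_mkcondr /=; apply: ler_sum => G _.
case: ifP => [/f1 fG|_]; first by rewrite -/(w G) ler_peMr.
by rewrite mulr_ge0.
Qed.

Lemma gnp_prob_sub A B :
  (forall G, G \subset pairs 'I_n -> A G -> B G) -> gnp_prob p A <= gnp_prob p B.
Proof.
move=> AB; rewrite /gnp_prob !big_mkcondr /=; apply: ler_sum => G GP.
case: ifP => [/(AB _ GP)->//|_]; case: ifP => // _; exact: w_ge0.
Qed.

Lemma gnp_prob_union (I : finType) (Q : pred I) (A : I -> pred (edge_set 'I_n)) :
  gnp_prob p (fun G => [exists (i | Q i), A i G]) <= \sum_(i | Q i) gnp_prob p (A i).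
Proof.
rewrite /gnp_prob (exchange_big_dep (fun G => G \subset pairs 'I_n)) /=; last by move=> i G _ /andP[].
rewrite big_mkcondr /=; apply: ler_sum => G GP; case: ifP => [|_]; last first.
  by apply: sumr_ge0 => i _; exact: w_ge0.
case/existsP=> i /andP[Qi Ai]; rewrite (bigD1 i) /=; last by rewrite Qi GP.
by rewrite lerDl; apply: sumr_ge0 => j _; exact: w_ge0.
Qed.

Lemma gnp_prob_or A B :
  gnp_prob p (fun G => A G || B G) <= gnp_prob p A + gnp_prob p B.
Proof.
rewrite /gnp_prob !big_mkcondr -big_split /=; apply: ler_sum => G _.
have := w_ge0 G; rewrite /w.
by case: (A G); case: (B G) => /= ?; rewrite ?addr0 ?add0r // lerDl.
Qed.

(** The moment generating function of the binomial variable [#|G :&: F|]. The sum factors, with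
    weight [p * t] instead of [p] on the edges of [F]. *)
Lemma gnp_mgf (t : R) F : F \subset pairs 'I_n ->
  \sum_(G : edge_set 'I_n | G \subset pairs 'I_n) w G * t ^+ #|G :&: F| =
  (1 - p + p * t) ^+ #|F|.
Proof.
move=> FP; pose a e := if e \in F then p * t else p.
transitivity (\sum_(G : edge_set 'I_n | G \subset pairs 'I_n)
    \prod_(e in pairs 'I_n) (if e \in G then a e else 1 - p)).
  apply: eq_bigr => G GP.
  have -> : t ^+ #|G :&: F| = \prod_(e in pairs 'I_n) (if e \in G :&: F then t else 1).
    rewrite -prodr_const -big_mkcondr /=; apply: eq_bigl => e.
    by rewrite !inE; case: (boolP (e \in F)) => [/(subsetP FP)|_];
      rewrite ?andbF // inE andbT => ->.
  rewrite -big_split /=; apply: eq_bigr => e _; rewrite inE /a.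
  by case: (e \in G); case: (e \in F); rewrite ?mulr1.
rewrite sum_edge_sets (bigID (mem F)) /= [X in _ * X]big1 => [|e].
  rewrite mulr1 -prodr_const; apply: eq_big => [e|e /andP[_ eF]].
    by case: (boolP (e \in F)) => [/(subsetP FP)->|]; rewrite ?andbF.
  by rewrite /a eF addrC.
by case/andP=> _ /negPf eF; rewrite /a eF addrC subrK.
Qed.

Lemma expRN1_le_half : expR (- 1) <= 2^-1 :> R.
Proof.
rewrite expRN lef_pV2 ?posrE ?expR_gt0 //.
by have := expR_ge1Dx (1 : R).
Qed.

Lemma expR_half_le2 : expR (2^-1) <= 2 :> R.
Proof.
rewrite -[X in expR X]opprK expRN -[leRHS]invrK lef_pV2 ?posrE ?expR_gt0 ?invr_gt0 //.
by apply: le_trans (expR_ge1Dx _); lra.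
Qed.

(** Chernoff bound with base [2^-1]: on the event [expR c * 2^-1 ^+ #|G :&: F|] is at least 1, and
    its mean is bounded by [1 - p / 2 <= expR (- (p / 2))]. *)
Lemma gnp_lower_tail (c : R) F : F \subset pairs 'I_n ->
  gnp_prob p (fun G => #|G :&: F|%:R <= c) <= expR (c - p * #|F|%:R / 2).
Proof.
move=> FP.
apply: le_trans (gnp_prob_markov _ (fun G => expR c * 2^-1 ^+ #|G :&: F|) _ _) _.
- by move=> G; rewrite mulr_ge0 ?expR_ge0 ?exprn_ge0 ?invr_ge0.
- move=> G Gc.
  have : expR (- 1) ^+ #|G :&: F| <= 2^-1 ^+ #|G :&: F| :> R.
    by apply: lerXn2r expRN1_le_half; rewrite nnegrE ?expR_ge0 ?invr_ge0.
  move=> /(ler_wpM2l (expR_ge0 c)); apply: le_trans.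
  rewrite -expRM_natl mulrN1 -expRD; apply: le_trans (expR_ge1Dx _).
  by rewrite lerDl subr_ge0.
under eq_bigr do rewrite mulrCA.
rewrite -mulr_sumr gnp_mgf // expRD ler_wpM2l ?expR_ge0 //.
have -> : - (p * #|F|%:R / 2) = #|F|%:R * - (p / 2) by rewrite mulrN mulrA (mulrC p).
rewrite expRM_natl; apply: lerXn2r; rewrite ?nnegrE ?expR_ge0 //.
  by rewrite addr_ge0 // divr_ge0.
by apply: le_trans (expR_ge1Dx _); lra.
Qed.

(** The same with base [2], from [expR (2^-1) <= 2] and [1 + p <= expR p]. *)
Lemma gnp_upper_tail (c : R) F : F \subset pairs 'I_n ->
  gnp_prob p (fun G => c <= #|G :&: F|%:R) <= expR (p * #|F|%:R - c / 2).
Proof.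
move=> FP.
apply: le_trans (gnp_prob_markov _ (fun G => expR (- (c / 2)) * 2 ^+ #|G :&: F|) _ _) _.
- by move=> G; rewrite mulr_ge0 ?expR_ge0 ?exprn_ge0.
- move=> G Gc.
  have : expR (2^-1) ^+ #|G :&: F| <= 2 ^+ #|G :&: F| :> R.
    by apply: lerXn2r expR_half_le2; rewrite nnegrE ?expR_ge0.
  move=> /(ler_wpM2l (expR_ge0 (- (c / 2)))); apply: le_trans.
  rewrite -expRM_natl -expRD; apply: le_trans (expR_ge1Dx _).
  by rewrite lerDl addrC subr_ge0 ler_wpM2r ?invr_ge0.
under eq_bigr do rewrite mulrCA.
rewrite -mulr_sumr gnp_mgf // expRD mulrC ler_wpM2r ?expR_ge0 //.
rewrite (mulrC p #|F|%:R) expRM_natl; apply: lerXn2r; rewrite ?nnegrE ?expR_ge0 //.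
  by rewrite addr_ge0 // mulr_ge0.
by apply: le_trans (expR_ge1Dx _); lra.
Qed.

(** The edges at [u] in the complete graph: degrees become counts [#|G :&: star u|], to which the
    tail bounds apply. *)
Let star (u : 'I_n) : edge_set 'I_n := [set e in pairs 'I_n | u \in e].

Lemma card_star u : #|star u| = n.-1.
Proof.
have -> : #|star u| = degree (pairs 'I_n) u by [].
rewrite degree_card // -[in RHS](card_ord n) -(cardsC1 u); apply: eq_card => x.
by rewrite !inE /adjacent inE cards2 eqSS eqb1 eq_sym.
Qed.

Lemma degree_star G u : G \subset pairs 'I_n -> degree G u = #|G :&: star u|.
Proof.
move=> GP; apply: eq_card => e; rewrite !inE.
by case: (boolP (e \in G)) => //= /(subsetP GP); rewrite inE => ->.
Qed.

Lemma gnp_resilience (k : nat) : (0 < n)%N ->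
  4 * p * n%:R <= p * k%:R ^+ 2 / 4 ->
  (6 * k + 8)%:R <= p * n.-1%:R / 4 ->
  gnp_prob p (fun G => (global_resilience (@hamiltonian 'I_n) G).+1 != min_degree G)
  <= n%:R * expR (- (p * n.-1%:R / 4)) + expR (- (p * n%:R))
     + (n%:R ^+ k) ^+ 2 * expR (- (p * k%:R ^+ 2 / 4)).
Proof.
move=> n0 hk hd.
pose Q (AB : {set 'I_n} * {set 'I_n}) :=
  [&& [disjoint AB.1 & AB.2], #|AB.1| == k & #|AB.2| == k].
pose bad1 u G := #|G :&: star u|%:R <= p * n.-1%:R / 4.
(* One vertex of degree below [4 * p * n] already bounds [min_degree G], so no union over vertices
   is taken here. *)
pose bad2 G := 4 * p * n%:R <= #|G :&: star (Ordinal n0)|%:R.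
pose bad3 (AB : {set 'I_n} * {set 'I_n}) G := #|G :&: cut AB.1 AB.2|%:R <= p * k%:R ^+ 2 / 4.
pose good1 G := [exists (u | xpredT u), bad1 u G].
pose good3 G := [exists (AB | Q AB), bad3 AB G].
apply: le_trans (gnp_prob_sub _ (fun G => (good1 G || bad2 G) || good3 G) _) _.
  move=> G GP; apply: contraR; rewrite !negb_or => /andP[/andP[n1 n2] n3].
  apply/eqP/(resilience_eq _ k) => //; first by rewrite card_ord.
    have [u <-] := min_degree_attained G (Ordinal n0) GP.
    move/existsPn: n1 => /(_ u) /=; rewrite /bad1 -ltNge -degree_star // => n1.
    by rewrite -(ler_nat R); apply: le_trans hd (ltW n1).
  move=> A B dis cA cB.
  move/existsPn: n3 => /(_ (A, B)); rewrite /Q /bad3 /= dis cA cB eqxx /= -ltNge => n3.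
  rewrite -(ler_nat R); apply: le_trans (ltW n3); apply: le_trans hk.
  move: n2; rewrite /bad2 -ltNge -degree_star // => n2.
  by apply: le_trans (ltW n2); rewrite ler_nat min_degree_le.
apply: le_trans (gnp_prob_or _ _) _; apply: lerD.
  apply: le_trans (gnp_prob_or _ _) _; apply: lerD.
    apply: le_trans (gnp_prob_union _ _ _) _.
    have -> : n%:R * expR (- (p * n.-1%:R / 4)) =
        \sum_(u : 'I_n | true) expR (- (p * n.-1%:R / 4)).
      by rewrite sumr_const card_ord mulr_natl.
    apply: ler_sum => u _; apply: le_trans (gnp_lower_tail _ _ _) _.
      by apply/subsetP => e; rewrite inE => /andP[].
    by rewrite ler_expR card_star; lra.
  apply: le_trans (gnp_upper_tail _ _ _) _.
    by apply/subsetP => e; rewrite inE => /andP[].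
  rewrite ler_expR card_star.
  have : p * n.-1%:R <= p * n%:R by rewrite ler_wpM2l // ler_nat leq_pred.
  by lra.
apply: le_trans (gnp_prob_union _ _ _) _.
(* Each of the two sets has at most ['C(n, k) <= n ^ k] choices. *)
have cQ : (#|Q| <= (n ^ k) ^ 2)%N.
  have bk : ('C(n, k) <= n ^ k)%N.
    apply: (@leq_trans (n ^_ k)); first by rewrite -bin_ffact leq_pmulr ?fact_gt0.
    rewrite ffact_prod -[k in leqRHS]card_ord -prod_nat_const.
    by apply: leq_prod => i _; exact: leq_subr.
  have := subset_leq_card (_ : Q \subset setX [set A : {set 'I_n} | #|A| == k]
      [set A : {set 'I_n} | #|A| == k]).
  rewrite cardsX !card_draws card_ord => H.
  apply: leq_trans (H _) _; last by rewrite -mulnn leq_mul.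
  by apply/subsetP => -[A B]; rewrite !inE /Q unfold_in /= => /and3P[_ -> ->].
apply: (@le_trans _ _ (\sum_(i in Q) expR (- (p * k%:R ^+ 2 / 4)))).
  apply: ler_sum => -[A B] /and3P[/= dis /eqP cA /eqP cB].
  apply: le_trans (gnp_lower_tail _ _ (cut_sub_pairs _ _ dis)) _.
  by rewrite ler_expR card_cut // cA cB natrM expr2; lra.
rewrite sumr_const -[leLHS]mulr_natl ler_wpM2r ?expR_ge0 //.
by rewrite -!natrX ler_nat.
Qed.

End Gnp.

(** * Asymptotics *)

Lemma expRN_le_inv {R : realType} (x : R) : 0 < x -> expR (- x) <= x^-1.
Proof.
move=> x0; rewrite expRN lef_pV2 ?posrE ?expR_gt0 //.
by apply: le_trans (expR_ge1Dx x); rewrite lerDr.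
Qed.

(** With [y = Num.sqrt z >= 80] one has [z / 40 >= 2 * y] and [expR (2 * y) >= (1 + y) ^ 2 >= z].
    The divisor 40 serves to give [z ^+ 10 <= expR (z / 4)]. *)
Lemma le_expR_div40 {R : realType} (z : R) : 6400 <= z -> z <= expR (z / 40).
Proof.
move=> z0; have zE : Num.sqrt z ^+ 2 = z by rewrite sqr_sqrtr; lra.
set y := Num.sqrt z in zE; have y0 : 0 <= y by exact: sqrtr_ge0.
have y80 : 80 <= y.
  by rewrite -(@ler_pXn2r _ 2) // ?nnegrE // ?zE; lra.
have yy : 2%:R * y <= z / 40 by rewrite -zE expr2; nra.
apply: le_trans (_ : expR (2%:R * y) <= _); last by rewrite ler_expR.
rewrite -zE expRM_natl; apply: lerXn2r; rewrite ?nnegrE ?expR_ge0 //.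
by apply: le_trans (expR_ge1Dx y); rewrite lerDr.
Qed.

(* Used with z = n^(1/10), so that p >= n^(-0.4) reads p z^4 >= 1; the three
   summands are those of [gnp_resilience]. *)
Lemma failure_bounds {R : realType} (z p : R) (n : nat) :
  6400 <= z -> z ^+ 10 = n%:R -> 1 <= p * z ^+ 4 -> 0 <= p ->
  exists k : nat, [/\ 4 * p * n%:R <= p * k%:R ^+ 2 / 4,
    (6 * k + 8)%:R <= p * n.-1%:R / 4 &
    n%:R * expR (- (p * n.-1%:R / 4)) + expR (- (p * n%:R))
     + (n%:R ^+ k) ^+ 2 * expR (- (p * k%:R ^+ 2 / 4)) <= 6 / z].
Proof.
(* [k] is just above [4 * z ^+ 5], which is [4 * sqrt n], so that [k ^ 2 / 4 >= 4 * n]. *)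
move=> z0 zn pz p0; exists (Num.truncn (4 * z ^+ 5)).+1.
set k := (Num.truncn _).+1; have zge0 : 0 <= z by lra.
have z5 : 1 <= z ^+ 5 by apply: exprn_ege1; lra.
have kl : 4 * z ^+ 5 <= k%:R by rewrite ltW // /k truncnS_gt.
have ku : k%:R <= 5 * z ^+ 5.
  have : (Num.truncn (4 * z ^+ 5))%:R <= 4 * z ^+ 5 by rewrite truncn_le; lra.
  by rewrite /k -natr1; lra.
have k1 : 1 <= k%:R :> R by lra.
have pn : z ^+ 6 <= p * n%:R.
  have -> : p * n%:R = p * z ^+ 4 * z ^+ 6 by rewrite -zn -mulrA -exprD.
  by rewrite ler_peMl ?exprn_ge0.
have pk : 4 * z <= p * k%:R.
  have : p * (4 * z ^+ 5) <= p * k%:R by rewrite ler_wpM2l.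
  have : 4 * z <= p * z ^+ 4 * (4 * z) by rewrite ler_peMl; lra.
  by rewrite !exprS expr0; lra.
have z6 : z ^+ 6 = z * z ^+ 5 by rewrite exprS.
have zz5 : 6400 * z ^+ 5 <= z * z ^+ 5 by rewrite ler_wpM2r; lra.
have z5z : z <= z ^+ 5 by apply: ler_eXnr => //; lra.
have pn1 : z ^+ 6 / 2 <= p * n.-1%:R.
  have n2 : 2 <= n%:R :> R.
    by rewrite -zn; apply: (@le_trans _ _ z); [lra|apply: ler_eXnr => //; lra].
  have -> : n.-1%:R = n%:R - 1 :> R.
    by rewrite -subn1 natrB // -(ler_nat R); lra.
  have : p * (n%:R / 2) <= p * (n%:R - 1) by rewrite ler_wpM2l //; lra.
  by lra.
(* Each of the three summands will be at most [expR (- (z / 2))], whence the total [6 / z]. *)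
have eh : expR (- (z / 2)) <= 2 / z.
  by rewrite -[2 / z]invf_div; apply: expRN_le_inv; lra.
have nexp : n%:R <= expR (z / 4).
  rewrite -zn; have -> : z / 4 = 10%:R * (z / 40) by lra.
  by rewrite expRM_natl; apply: lerXn2r; rewrite ?nnegrE ?expR_ge0 ?le_expR_div40.
split.
- have : p * (4 * z ^+ 5) ^+ 2 <= p * k%:R ^+ 2.
    by rewrite ler_wpM2l // lerXn2r // nnegrE; lra.
  by rewrite -zn (_ : (4 * z ^+ 5) ^+ 2 = 16 * z ^+ 10); [lra|ring].
- rewrite natrD natrM; lra.
- have T1 : n%:R * expR (- (p * n.-1%:R / 4)) <= expR (- (z / 2)).
    apply: le_trans (ler_wpM2r (expR_ge0 _) nexp) _.
    by rewrite -expRD ler_expR; lra.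
  have T2 : expR (- (p * n%:R)) <= expR (- (z / 2)) by rewrite ler_expR; lra.
  (* Choosing the sets costs a factor of at most [expR (k * z / 2)], while [p * k >= 4 * z] gives
     [p * k ^ 2 / 4 >= k * z]. *)
  have T3 : (n%:R ^+ k) ^+ 2 * expR (- (p * k%:R ^+ 2 / 4)) <= expR (- (z / 2)).
    have nk : (n%:R ^+ k) ^+ 2 <= expR ((k * 2)%:R * (z / 4)).
      by rewrite -exprM expRM_natl lerXn2r // nnegrE ?expR_ge0.
    apply: le_trans (ler_wpM2r (expR_ge0 _) nk) _.
    rewrite -expRD ler_expR natrM.
    have : k%:R * (4 * z) <= k%:R * (p * k%:R) by rewrite ler_wpM2l //; lra.
    have : z <= k%:R * z by rewrite ler_peMl.
    by rewrite expr2; lra.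
  lra.
Qed.

Local Open Scope classical_set_scope.

Theorem theorem4 (R : realType) (p : nat -> R)
    (hp : forall n : nat, (0 < n)%N -> n%:R `^ (- (4 / 10)) <= p n <= 1) :
  (fun n : nat =>
     @gnp_prob R n (p n) (fun G : edge_set 'I_n =>
       (global_resilience (@hamiltonian 'I_n) G)%:Z == (min_degree G)%:Z - 1))
    @ \oo --> (1 : R).
Proof.
apply/cvgrPdist_le => eps eps0.
(* [6400] is the threshold of [failure_bounds]; [6 / eps] turns its bound [6 / z] into [eps]. *)
pose M : R := Num.max 6400 (6 / eps).
have M6400 : 6400 <= M by rewrite le_max lexx.
near=> n.
have nM : M ^+ 10 <= n%:R by near: n; exact: nbhs_infty_ger.
have n0 : (0 < n)%N.
  rewrite -(ltr_nat R); apply: lt_le_trans nM.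
  by rewrite exprn_gt0; lra.
pose z : R := n%:R `^ (10^-1).
have z0 : 0 <= z by exact: powR_ge0.
have zn : z ^+ 10 = n%:R.
  by rewrite -powR_mulrn // -powRrM mulVf ?powRr1.
have Mz : M <= z by rewrite -(@ler_pXn2r _ 10) ?zn // nnegrE //; lra.
have /andP[pl pu] := hp n n0.
have p0 : 0 <= p n by apply: le_trans pl; exact: powR_ge0.
have pz : 1 <= p n * z ^+ 4.
  have pE : n%:R `^ (- (4 / 10)) = (z ^+ 4)^-1 :> R.
    by rewrite powRN -powR_mulrn // -powRrM mulrC.
  by rewrite -ler_pdivrMr ?exprn_gt0 ?div1r -?pE //; lra.
have zM : 6400 <= z by lra.
have [k [hk hd hf]] := failure_bounds z (p n) n zM zn pz p0.
have p01 : 0 <= p n <= 1 by rewrite p0.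
rewrite gnp_prob_predC // opprB addrC subrK.
set A := predC _.
have A0 : 0 <= gnp_prob (p n) A.
  apply: sumr_ge0 => G _; apply: prodr_ge0 => e _.
  by case: ifP; rewrite ?subr_ge0.
rewrite ger0_norm //.
apply: le_trans (gnp_prob_sub _ p01 _
  (fun G => (global_resilience (@hamiltonian 'I_n) G).+1 != min_degree G) _) _.
  (* The integer equation with [- 1] follows from the equation of naturals with [.+1]. *)
  move=> G _; rewrite /A /=; apply: contra => /eqP <-.
  by rewrite intS addrAC subrr add0r.
apply: le_trans (gnp_resilience _ p01 k n0 hk hd) _; apply: le_trans hf _.
rewrite ler_pdivrMr; last by lra.
rewrite mulrC -ler_pdivrMr //; apply: le_trans Mz.
by rewrite le_max lexx orbT.
Unshelve. all: by end_near.
Qed.
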